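(* Let $f_1,\dots,f_m:\mathbb{R}^n\to\mathbb{R}$ be differentiable functions with $L$-Lipschitz continuous gradients, and let $g_1,\dots,g_m:\mathbb{R}\to\mathbb{R}$ be strictly increasing and differentiable functions. Then for $x\in\mathbb{R}^n$ the central descent direction $V_c(x)$ calculated with respect to the objective functions $f_1,\dots,f_m$ is equal to the central descent direction calculated with respect to the objective functions $g_1\circ f_1,\dots,g_m\circ f_m$.
   Context: $\|\cdot\|$ is the Euclidean norm. $L$-Lipschitz gradients means that for some $L\ge0$, $\|\nabla f_i(x)-\nabla f_i(y)\|\le L\|x-y\|$ for all $x,y\in\mathbb{R}^n$ and all $i$. Central descent direction: for differentiable objective functions $h_1,\dots,h_m:\mathbb{R}^n\to\mathbb{R}$ and $x\in\mathbb{R}^n$, the central descent direction at $x$ calculated with respect to $h_1,\dots,h_m$ is the unique minimizer of $\tfrac12\|V\|^2$ over all $V\in\mathbb{R}^n$ satisfying $\nabla h_i(x)^T V\le -\|\nabla h_i(x)\|$ for all $i=1,\dots,m$; it is said to be empty if no such $V$ exists.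
   Formalization: The formal theorem also assumes that g_i'(f_i(x)) is nonzero for every i at the given x; without this the claim fails, e.g. n = m = 1, f(y) = y, g(t) = t^3, x = 0, where the central descent directions are -1 and 0. *)

(* Defs.v *)
From HB Require Import structures.
From mathcomp Require Import all_boot all_order all_algebra.
From mathcomp Require Import boolp classical_sets functions reals topology.
From mathcomp Require Import normedtype derive realfun.
From mathcomp Require Import ring lra.

Set Implicit Arguments.
Unset Strict Implicit.
Unset Printing Implicit Defensive.

Import Order.TTheory GRing.Theory Num.Theory.
Import numFieldNormedType.Exports.

Local Open Scope classical_set_scope.
Local Open Scope ring_scope.

Definition dot (R : realType) (n : nat) (u v : 'rV[R]_n) : R :=
  \sum_(j < n) u 0 j * v 0 j.

(* The library norm `|u| on 'rV[R]_n is the sup norm; it only provides the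
   topology (hence the notion of differentiability), which is the usual one. *)
Definition eucl_norm (R : realType) (n : nat) (u : 'rV[R]_n) : R :=
  Num.sqrt (dot u u).

Definition gradient (R : realType) (n : nat) (h : 'rV[R]_n -> R)
    (x : 'rV[R]_n) : 'rV[R]_n :=
  \row_(j < n) 'D_(delta_mx 0 j) h x.

Definition lipschitz_gradient (R : realType) (n : nat) (L : R)
    (h : 'rV[R]_n -> R) : Prop :=
  forall x y : 'rV[R]_n,
    eucl_norm (gradient h x - gradient h y) <= L * eucl_norm (x - y).

Definition feasible (R : realType) (n m : nat) (h : 'I_m -> 'rV[R]_n -> R)
    (x : 'rV[R]_n) : set 'rV[R]_n :=
  [set V | forall i : 'I_m,
     dot (gradient (h i) x) V <= - eucl_norm (gradient (h i) x)].

Definition is_central_descent_direction (R : realType) (n m : nat)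
    (h : 'I_m -> 'rV[R]_n -> R) (x V : 'rV[R]_n) : Prop :=
  feasible h x V /\
  forall W : 'rV[R]_n, feasible h x W ->
    2^-1 * eucl_norm V ^+ 2 <= 2^-1 * eucl_norm W ^+ 2.

(* None stands for the empty central descent direction. *)
Definition central_descent_direction (R : realType) (n m : nat)
    (h : 'I_m -> 'rV[R]_n -> R) (x : 'rV[R]_n) : option 'rV[R]_n :=
  if pselect (feasible h x !=set0) then
    Some (xget 0 [set V | is_central_descent_direction h x V])
  else None.

Section WellDefined.
Context {R : realType} {n m : nat}.
Implicit Types (u v w : 'rV[R]_n) (h : 'I_m -> 'rV[R]_n -> R).

Lemma dotC u v : dot u v = dot v u.
Proof. by apply: eq_bigr => j _; rewrite mulrC. Qed.

Lemma dotDr u v w : dot u (v + w) = dot u v + dot u w.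
Proof. by rewrite /dot -big_split/=; apply: eq_bigr => j _; rewrite mxE mulrDr. Qed.

Lemma dotZr a u v : dot u (a *: v) = a * dot u v.
Proof. by rewrite /dot mulr_sumr; apply: eq_bigr => j _; rewrite mxE mulrCA. Qed.

Lemma dot_ge0 u : 0 <= dot u u.
Proof. by apply: sumr_ge0 => j _; rewrite -expr2 sqr_ge0. Qed.

Lemma dot_eq0 u : dot u u = 0 -> u = 0.
Proof.
move=> /eqP; rewrite psumr_eq0 => [/allP u0|j _]; last by rewrite -expr2 sqr_ge0.
apply/rowP => j; have := u0 j (mem_index_enum _).
by rewrite mulf_eq0 orbb mxE => /eqP.
Qed.

Lemma eucl_norm_sqr u : eucl_norm u ^+ 2 = dot u u.
Proof. by rewrite sqr_sqrtr // dot_ge0. Qed.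

Lemma continuous_sum (F : 'I_n -> 'rV[R]_n -> R) :
  (forall j, continuous (F j)) -> continuous (fun v => \sum_(j < n) F j v).
Proof.
move=> cF; elim: (index_enum _) => [|j r IHr] v.
  rewrite (_ : (fun _ => _) = cst 0); last first.
    by apply/funext => w; rewrite big_nil.
  exact: cst_continuous.
rewrite (_ : (fun _ => _) = F j + (fun w => \sum_(k <- r) F k w)); last first.
  by apply/funext => w; rewrite big_cons.
by apply: continuousD; [exact: cF | exact: IHr].
Qed.

Lemma continuous_dotr u : continuous (dot u : 'rV[R]_n -> R).
Proof.
apply: continuous_sum => j v.
by apply: continuousM; [exact: cst_continuous | exact: coord_continuous].
Qed.

Lemma continuous_dot : continuous (fun u : 'rV[R]_n => dot u u).
Proof.
by apply: continuous_sum => j v; apply: continuousM; exact: coord_continuous.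
Qed.

Lemma closed_feasible h x : closed (feasible h x).
Proof.
rewrite (_ : feasible h x = \bigcap_(i in [set: 'I_m])
  (dot (gradient (h i) x) @^-1` [set t | t <= - eucl_norm (gradient (h i) x)])).
  apply: closed_bigI => i _; apply: preimage_closed => [V _|].
    exact: continuous_dotr.
  exact: closed_le.
by apply/seteqP; split => [V hV i _|V hV i]; [exact: hV | exact: (hV i I)].
Qed.

Lemma central_descent_direction_exists h x :
  feasible h x !=set0 -> exists V, is_central_descent_direction h x V.
Proof.
move=> [W0 FW0].
pose A := feasible h x `&` [set V | dot V V <= dot W0 W0].
have A0 : A !=set0 by exists W0; split => //=.
have cA : compact A.
  apply: bounded_closed_compact.
    exists (1 + dot W0 W0); split; first by rewrite num_real.
    move=> M hM V [_ /= VW].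
    rewrite /Num.norm/= mx_normrE; apply: bigmax_le => [|[i j] _ /=].
      by have := dot_ge0 W0; lra.
    have Vj : V i j ^+ 2 <= dot V V.
      rewrite ord1 /dot (bigD1 j)//= -expr2 lerDl.
      by apply: sumr_ge0 => k _; rewrite -expr2 sqr_ge0.
    have := real_normK (num_real (V i j)).
    have := normr_ge0 (V i j); move: `|V i j| => t.
    by move: (dot_ge0 W0) => *; nra.
  apply: closedI; first exact: closed_feasible.
  apply: (@preimage_closed _ _ (fun V => dot V V) [set t | t <= dot W0 W0]).
    by move=> V _; exact: continuous_dot.
  exact: closed_le.
have [|V /set_mem[FV VW] Vmin] := @EVT_min_rV R n (fun V => dot V V) A A0 cA.
  by apply: continuous_subspaceT; exact: continuous_dot.
exists V; split => // W FW; rewrite !eucl_norm_sqr ler_pM2l ?invr_gt0//.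
have [WW|/ltW WW] := leP (dot W W) (dot W0 W0).
  by apply: Vmin; rewrite inE; split.
exact: le_trans VW WW.
Qed.

Lemma central_descent_direction_unique h x V W :
  is_central_descent_direction h x V -> is_central_descent_direction h x W ->
  V = W.
Proof.
move=> [FV minV] [FW minW]; apply/eqP; rewrite -subr_eq0; apply/eqP/dot_eq0.
pose U := 2^-1 *: (V + W).
have FU : feasible h x U.
  by move=> i; rewrite dotZr dotDr; have := FV i; have := FW i; lra.
have parallelogram :
    dot (V - W) (V - W) = 2 * dot V V + 2 * dot W W - 4 * dot U U.
  rewrite /dot !mulr_sumr -sumrN -!big_split /=; apply: eq_bigr => j _.
  by rewrite !mxE; field.
have := minV _ FU; have := minW _ FU; have := dot_ge0 (V - W).
rewrite !eucl_norm_sqr parallelogram; lra.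
Qed.

Lemma central_descent_directionP h x V :
  central_descent_direction h x = Some V <-> is_central_descent_direction h x V.
Proof.
rewrite /central_descent_direction; case: pselect => [F0|F0] /=.
  have ex := xgetPex 0 (central_descent_direction_exists F0).
  split => [[<-] //|cV]; congr Some.
  exact: central_descent_direction_unique ex cV.
by split => // -[FV _]; case: F0; exists V.
Qed.

Lemma central_descent_direction_None h x :
  central_descent_direction h x = None <-> feasible h x = set0.
Proof.
rewrite /central_descent_direction; case: pselect => [F0|F0] /=.
  by split => // F; case: F0; rewrite F => ? [].
by split => // _; apply/eqP/negPn/negP => /set0P.
Qed.

End WellDefined.

(* Main.v *)
Require Import Defs.
From HB Require Import structures.
From mathcomp Require Import all_boot all_order all_algebra.
From mathcomp Require Import boolp classical_sets functions reals topology.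
From mathcomp Require Import normedtype derive realfun.

Set Implicit Arguments.
Unset Strict Implicit.
Unset Printing Implicit Defensive.

Import Order.TTheory GRing.Theory Num.Theory.
Import numFieldNormedType.Exports.

Local Open Scope classical_set_scope.
Local Open Scope ring_scope.

(** The central descent direction depends on the objectives only through the set
of feasible vectors [V], the solutions of [grad h_i(x)^T V <= - |grad h_i(x)|].
By the chain rule, replacing [f_i] by [g_i \o f_i] multiplies [grad f_i(x)] by
the scalar [c_i = g_i'(f_i(x))] ([gradient_comp]). This scalar is nonnegative
since [g_i] is increasing, hence positive since it is nonzero. Both sides of the
[i]-th inequality are positively homogeneous in the gradient, so they are scaled
by the same [c_i > 0] and the solution set does not change
([descent_constraintZ]). *)

Lemma dotZl (R : realType) (n : nat) (a : R) (u v : 'rV[R]_n) :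
  dot (a *: u) v = a * dot u v.
Proof. by rewrite dotC dotZr dotC. Qed.

Lemma eucl_normZ (R : realType) (n : nat) (a : R) (u : 'rV[R]_n) :
  eucl_norm (a *: u) = `|a| * eucl_norm u.
Proof.
by rewrite /eucl_norm dotZl dotZr mulrA -expr2 sqrtrM ?sqr_ge0// sqrtr_sqr.
Qed.

(** The one-objective constraint sees only the direction of the gradient [u],
because both of its sides are positively homogeneous in [u]. *)
Lemma descent_constraintZ (R : realType) (n : nat) (c : R) (u V : 'rV[R]_n) :
  0 < c ->
  (dot (c *: u) V <= - eucl_norm (c *: u)) = (dot u V <= - eucl_norm u).
Proof. by move=> c0; rewrite dotZl eucl_normZ gtr0_norm// -mulrN ler_pM2l. Qed.

Lemma gradient_comp (R : realType) (n : nat) (h : 'rV[R]_n -> R) (k : R -> R)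
    (x : 'rV[R]_n) :
  differentiable h x -> derivable k (h x) 1 ->
  gradient (k \o h) x = derive1 k (h x) *: gradient h x.
Proof.
move=> dh /derivable1_diffP dk; apply/rowP => j; rewrite !mxE.
rewrite deriveE; last exact: differentiable_comp.
(* A linear map on the line is multiplication by its value at 1. *)
by rewrite diff_comp// (deriveE _ dh) /= diff1E// mulrC.
Qed.

(** Strict monotonicity alone only makes the limit of the positive difference
quotients nonnegative: the cube function is increasing and has derivative [0]
at [0]. *)
Lemma incr_derive1_gt0 (R : realType) (k : R -> R) (t : R) :
  {homo k : s t / s < t} -> (forall s, derivable k s 1) ->
  derive1 k t != 0 -> 0 < derive1 k t.
Proof.
move=> k_incr dk k'_neq0; rewrite lt_neqAle eq_sym k'_neq0 /=.
apply: (@incr_derive1_ge0 _ _ setT) => [s _|s s' _ _|].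
- exact: dk.
- exact: k_incr.
- by rewrite interiorT.
Qed.

(** Feasible sets determine central descent directions: the quantity minimized
does not involve the objectives. *)
Lemma eq_central_descent_direction (R : realType) (n m : nat)
    (h k : 'I_m -> 'rV[R]_n -> R) (x : 'rV[R]_n) :
  feasible h x = feasible k x ->
  central_descent_direction h x = central_descent_direction k x.
Proof.
by rewrite /central_descent_direction /is_central_descent_direction => ->.
Qed.

(* The hypothesis derive1 (g i) (f i x) != 0 cannot be dropped: with m = n = 1, f = id,
   g t = t ^+ 3 and x = 0, the central descent direction is -1 for f and 0 for
   g \o f. *)
Theorem proposition2p5 (R : realType) (n m : nat) (L : R) (hL : 0 <= L)
    (f : 'I_m -> 'rV[R]_n -> R) (g : 'I_m -> R -> R)
    (f_diff : forall (i : 'I_m) (x : 'rV[R]_n), differentiable (f i) x)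
    (f_lip : forall i : 'I_m, lipschitz_gradient L (f i))
    (g_incr : forall i : 'I_m, {homo g i : s t / s < t})
    (g_diff : forall (i : 'I_m) (t : R), derivable (g i) t 1)
    (x : 'rV[R]_n)
    (g_nondeg : forall i : 'I_m, derive1 (g i) (f i x) != 0) :
  central_descent_direction f x =
  central_descent_direction (fun i : 'I_m => g i \o f i) x.
Proof.
have c_gt0 i : 0 < derive1 (g i) (f i x).
  by apply: incr_derive1_gt0; [exact: g_incr | exact: g_diff | exact: g_nondeg].
apply: eq_central_descent_direction; apply/seteqP.
by split=> V FV i; have := FV i;
  rewrite gradient_comp ?descent_constraintZ.
Qed.
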